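(* Let $A$ be a Banach algebra, $B$ a Banach $A$-bimodule, and $n\ge 2$ an odd integer. Then: (1) If $B^{(n)}B^{(n-1)}\subseteq A^{(n-2)}$, then $Z^\ell_{A^{(n-1)}}(B^{(n-1)})=\tilde Z^\ell_{A^{(n-1)}}(B^{(n-1)})$. (2) If $B^{(n)}A^{(n-1)}\subseteq B^{(n-2)}$ and $B^{(n-1)}$ has a left unit $A^{(n-1)}$-module, then $B$ is reflexive.
   Context: $X^{(0)}=X$ and $X^{(k)}$ is the dual of $X^{(k-1)}$; $X^{(k)}$ is regarded as a subspace of $X^{(k+2)}$ canonically. For a bounded bilinear map $m:X\times Y\to Z$ define $m^*:Z^*\times X\to Y^*$, $m^{**}:Y^{**}\times Z^*\to X^*$, $m^{***}:X^{**}\times Y^{**}\to Z^{**}$ by $\langle m^*(z',x),y\rangle=\langle z',m(x,y)\rangle$, $\langle m^{**}(y'',z'),x\rangle=\langle y'',m^*(z',x)\rangle$, $\langle m^{***}(x'',y''),z'\rangle=\langle x'',m^{**}(y'',z')\rangle$. For even $k$, $A^{(k)}$ is a Banach algebra and $B^{(k)}$ a Banach $A^{(k)}$-bimodule, inductively: passing from $k$ to $k+2$, the product of $A^{(k)}$ and the left and right module actions $\pi_\ell:A^{(k)}\times B^{(k)}\to B^{(k)}$, $\pi_r:B^{(k)}\times A^{(k)}\to B^{(k)}$ are replaced by their extensions $m^{***}$ (first Arens product and $\pi_\ell^{***},\pi_r^{***}$); all are written by juxtaposition. For even $k$, $b^{(k+1)}\in B^{(k+1)}$, $b^{(k)}\in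 B^{(k)}$, $a^{(k)}\in A^{(k)}$: $b^{(k+1)}b^{(k)}\in A^{(k+1)}$ is defined by $\langle b^{(k+1)}b^{(k)},a^{(k)}\rangle=\langle b^{(k+1)},b^{(k)}a^{(k)}\rangle$, and $b^{(k+1)}a^{(k)}\in B^{(k+1)}$ by $\langle b^{(k+1)}a^{(k)},b^{(k)}\rangle=\langle b^{(k+1)},a^{(k)}b^{(k)}\rangle$. $XY=\{xy:x\in X,y\in Y\}$. For even $k\geq 2$: $Z^\ell_{A^{(k)}}(B^{(k)})=\{b\in B^{(k)}: a\mapsto ba,\ A^{(k)}\to B^{(k)},\text{ is weak}^*\text{-to-weak}^*\text{ continuous}\}$; $\tilde Z^\ell_{A^{(k)}}(B^{(k)})=\{b\in B^{(k)}: a\mapsto ba,\ A^{(k)}\to B^{(k)},\text{ is weak}^*\text{-to-weak continuous}\}$. Here weak$^*$ on $X^{(k)}$ is $\sigma(X^{(k)},X^{(k-1)})$ and weak is $\sigma(X^{(k)},X^{(k+1)})$. $B^{(k)}$ has a left unit $A^{(k)}$-module if there is a left unit element $e$ of the algebra $A^{(k)}$ with $eb=b$ for all $b\in B^{(k)}$. *)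

(* Defs.v *)
From HB Require Import structures.
From mathcomp Require Import all_boot all_order all_algebra.
From mathcomp Require Import complex.
From mathcomp Require Import all_classical all_reals.
From mathcomp Require Import topology normedtype.

Set Implicit Arguments.
Unset Strict Implicit.
Unset Printing Implicit Defensive.

Import Order.TTheory GRing.Theory Num.Theory.
Import numFieldNormedType.Exports.

Local Open Scope classical_set_scope.
Local Open Scope ring_scope.

Variant scalar_kind := RealScalars | ComplexScalars.

Definition scalars (R : realType) (s : scalar_kind) : numFieldType :=
  match s with RealScalars => R | ComplexScalars => R[i] end.

Lemma scalars_supremum (R : realType) (s : scalar_kind)
    (S : set (scalars R s)) :
  S !=set0 -> (forall x, S x -> 0 <= x) -> ubound S !=set0 ->
  supremums S !=set0.
Proof.
case: s S => /= S [x Sx] S0 [M SM].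
  exists (sup S); split.
    by apply: sup_upper_bound; split; [exists x|exists M].
  by move=> y Sy; apply: ge_sup => //; exists x.
have Sre y : S y -> y = (complex.Re y)%:C%C.
  by move=> /S0; case: y => a b; rewrite lecE /= => /andP[/eqP -> _].
have M0 : M = (complex.Re M)%:C%C.
  have := le_trans (S0 _ Sx) (SM _ Sx).
  by case: M {SM} => a b; rewrite lecE /= => /andP[/eqP -> _].
have Sle y z : z = (complex.Re z)%:C%C -> S y ->
    (y <= z) = (complex.Re y <= complex.Re z).
  by move=> -> /Sre ->; rewrite lecR.
have hs : has_sup [set complex.Re y | y in S].
  split; first by exists (complex.Re x), x.
  by exists (complex.Re M) => _ [y Sy <-]; rewrite -Sle// SM.
exists (sup [set complex.Re y | y in S])%:C%C; split => [y Sy|z Sz].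
  by rewrite Sle//=; apply: sup_upper_bound => //; exists y.
have zr : z = (complex.Re z)%:C%C.
  have := le_trans (S0 _ Sx) (Sz _ Sx).
  by case: z {Sz} => a b; rewrite lecE /= => /andP[/eqP -> _].
rewrite zr lecR; apply: ge_sup; first by case: hs.
by move=> _ [y Sy <-]; rewrite -Sle// Sz.
Qed.

Section Dual.
Context {R : realType} {s : scalar_kind}.
Local Notation K := (scalars R s).
Variable X : normedModType K.

Definition bounded_functional : {pred X -> K^o} :=
  fun f => `[< linear f /\ continuous f >].

Record dual := Dual {
  dual_fun :> X -> K^o;
  _ : dual_fun \in bounded_functional
}.

HB.instance Definition _ := [isSub for dual_fun].
HB.instance Definition _ := [Choice of dual by <:].

Lemma bounded_functional_submod : submod_closed bounded_functional.
Proof.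
split.
  apply/asboolP; split=> [a u v|]; last exact: cst_continuous.
  by rewrite /= scaler0 addr0.
move=> a f g /asboolP[lf cf] /asboolP[lg cg]; apply/asboolP; split.
  move=> c u v; rewrite !fctE lf lg !scalerDr !scalerA (mulrC a c) -!addrA.
  by congr (_ + _); rewrite addrCA.
move=> x; apply: cvgD; last exact: cg.
by apply: cvgZr; exact: cf.
Qed.

HB.instance Definition _ :=
  GRing.isSubmodClosed.Build K (X -> K^o) bounded_functional
    bounded_functional_submod.
HB.instance Definition _ := [SubChoice_isSubLmodule of dual by <:].

Lemma dual_linear (f : dual) : linear (dual_fun f).
Proof. by case: f => f /= /asboolP[]. Qed.

Lemma dual_continuous (f : dual) : continuous (dual_fun f).
Proof. by case: f => f /= /asboolP[]. Qed.

HB.instance Definition _ (f : dual) :=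
  GRing.isLinear.Build K X K^o _ (dual_fun f) (dual_linear f).

Lemma dual_bound (f : dual) :
  exists2 M : K, 0 <= M & forall x, `|dual_fun f x| <= M * `|x|.
Proof.
have /linear_bounded_continuous/linear_boundedP := @dual_continuous f.
by move=> /pinfty_ex_gt0[M /ltW M0 fM]; exists M.
Qed.

Lemma mk_dual_subproof (f : X -> K^o) (lf : linear f) (M : K) :
  0 <= M -> (forall x, `|f x| <= M * `|x|) -> f \in bounded_functional.
Proof.
move=> M0 fM; apply/asboolP; split=> //.
pose F : {linear X -> K^o} := HB.pack f (GRing.isLinear.Build K X K^o _ f lf).
apply: (bounded_linear_continuous (f := F)).
apply/bounded_funP => r; exists (M * r) => x xr.
by rewrite (le_trans (fM x))// ler_wpM2l.
Qed.

Definition op_norm (f : dual) : K :=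
  supremum 0 [set `|dual_fun f x| | x in [set x | `|x| <= 1]].

Lemma op_norm_supremums (f : dual) :
  supremums [set `|dual_fun f x| | x in [set x | `|x| <= 1]] (op_norm f).
Proof.
have ne : [set `|dual_fun f x| | x in [set x | `|x| <= 1]] !=set0.
  by exists `|dual_fun f 0|, 0; rewrite //= normr0.
rewrite /op_norm /supremum; case: ifPn => [/eqP e0|_].
  by move: ne; rewrite e0 => -[].
apply: xgetPex; apply: scalars_supremum => //; first by move=> _ [x _ <-].
have [M M0 fM] := dual_bound f; exists M => _ [x /= x1 <-].
by rewrite (le_trans (fM x))// ler_piMr.
Qed.

Lemma op_norm_ge0 (f : dual) : 0 <= op_norm f.
Proof.
have [ub _] := op_norm_supremums f.
by apply: le_trans (ub `|dual_fun f 0| _) => //; exists 0; rewrite //= normr0.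
Qed.

Lemma le_op_norm (f : dual) (x : X) : `|dual_fun f x| <= op_norm f * `|x|.
Proof.
have [->|x0] := eqVneq x 0; first by rewrite linear0 !normr0 mulr0.
have [ub _] := op_norm_supremums f.
rewrite -ler_pdivrMr ?normr_gt0//.
apply: ub; exists (`|x|^-1 *: x).
  by rewrite /= normrZ normfV normr_id mulVf ?normr_eq0.
by rewrite linearZ/= normrM normfV normr_id mulrC.
Qed.

Lemma op_norm_le (f : dual) (M : K) : 0 <= M ->
  (forall x, `|dual_fun f x| <= M * `|x|) -> op_norm f <= M.
Proof.
move=> M0 fM; have [_] := op_norm_supremums f; apply => _ [x /= x1 <-].
by rewrite (le_trans (fM x))// ler_piMr.
Qed.

Lemma op_normD (f g : dual) : op_norm (f + g) <= op_norm f + op_norm g.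
Proof.
apply: op_norm_le => [|x]; first by rewrite addr_ge0// op_norm_ge0.
by rewrite mulrDl (le_trans (ler_normD _ _))// lerD// le_op_norm.
Qed.

Lemma op_normZ (a : K) (f : dual) : op_norm (a *: f) = `|a| * op_norm f.
Proof.
have le b g : op_norm (b *: g) <= `|b| * op_norm g.
  apply: op_norm_le => [|x]; first by rewrite mulr_ge0// op_norm_ge0.
  by rewrite /= normrZ -mulrA ler_wpM2l// le_op_norm.
apply/eqP; rewrite eq_le le/=.
have [->|a0] := eqVneq a 0; first by rewrite normr0 mul0r op_norm_ge0.
rewrite -ler_pdivlMl ?normr_gt0// -normfV.
by rewrite -{1}(scalerK a0 f) le.
Qed.

Lemma op_norm_eq0 (f : dual) : op_norm f = 0 -> f = 0.
Proof.
move=> f0; apply/val_inj/funext => x.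
by apply/eqP; rewrite -normr_le0 (le_trans (le_op_norm f x))// f0 mul0r.
Qed.

HB.instance Definition _ :=
  Lmodule_isNormed.Build K dual op_normD op_normZ op_norm_eq0.

End Dual.

Section Canonical.
Context {R : realType} {s : scalar_kind}.
Local Notation K := (scalars R s).
Variable X : normedModType K.

Lemma bidual_emb_subproof (x : X) :
  (fun f : dual X => f x) \in @bounded_functional R s (dual X).
Proof.
apply: (@mk_dual_subproof _ _ _ _ _ `|x|) => // f.
by rewrite mulrC; exact: le_op_norm.
Qed.

Definition bidual_emb (x : X) : dual (dual X) := Dual (bidual_emb_subproof x).

Definition reflexive_space := range bidual_emb = setT.

(* sigma(X', X) on X' *)
Definition weak_star := @initial_topology (dual X) {ptws X -> K^o}
  (fun f => f : X -> K^o).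
HB.instance Definition _ := Topological.on weak_star.

(* sigma(X, X') on X *)
Definition weak := @initial_topology X {ptws dual X -> K^o}
  (fun x => bidual_emb x : dual X -> K^o).
HB.instance Definition _ := Topological.on weak.

End Canonical.

Section Bilinear.
Context {R : realType} {s : scalar_kind}.
Local Notation K := (scalars R s).

Record bounded_bilinear (X Y Z : normedModType K) := BoundedBilinear {
  bilin_fun :> X -> Y -> Z;
  bilin_linearl : forall y, linear (fun x => bilin_fun x y);
  bilin_linearr : forall x, linear (bilin_fun x);
  bilin_bounded :
    exists M : K, forall x y, `|bilin_fun x y| <= M * `|x| * `|y|
}.

Section Adjoint.
Variables (X Y Z : normedModType K) (m : bounded_bilinear X Y Z).

Lemma bilin_bound :
  exists2 M : K, 0 <= M & forall x y, `|m x y| <= M * `|x| * `|y|.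
Proof.
have [M mM] := bilin_bounded m; exists `|M| => // x y.
have := mM x y; have := le_trans (normr_ge0 _) (mM x y).
by move=> /ger0_norm <-; rewrite !normrM !normr_id.
Qed.

Lemma adj_fun_subproof (z' : dual Z) (x : X) :
  (fun y => z' (m x y)) \in bounded_functional (X := Y).
Proof.
have [M M0 mM] := bilin_bound.
apply: (@mk_dual_subproof _ _ _ _ _ (op_norm z' * (M * `|x|))).
- by move=> a u v; rewrite bilin_linearr linearP.
- by rewrite !mulr_ge0// op_norm_ge0.
- move=> y; rewrite (le_trans (le_op_norm _ _))// -mulrA.
  by rewrite ler_wpM2l// op_norm_ge0.
Qed.

Definition adj_fun (z' : dual Z) (x : X) : dual Y :=
  Dual (adj_fun_subproof z' x).

Lemma adj_linearl x : linear (fun z' => adj_fun z' x).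
Proof. by move=> a u v; apply/val_inj/funext. Qed.

Lemma adj_linearr z' : linear (adj_fun z').
Proof.
move=> a u v; apply/val_inj/funext => y /=.
by rewrite bilin_linearl linearP.
Qed.

Lemma adj_bounded :
  exists M : K, forall z' x, `|adj_fun z' x| <= M * `|z'| * `|x|.
Proof.
have [M M0 mM] := bilin_bound; exists M => z' x.
apply: op_norm_le => [|y]; first by rewrite !mulr_ge0.
apply: (le_trans (le_op_norm z' (m x y))); rewrite (mulrC M) -!mulrA.
by rewrite ler_wpM2l ?op_norm_ge0// mulrA.
Qed.

(* <adj m z' x, y> = <z', m x y>: the first adjoint of m, whose third iterate
   is the Arens extension X'' x Y'' -> Z'' *)
Definition adj : bounded_bilinear (dual Z) X (dual Y) :=
  BoundedBilinear adj_linearl adj_linearr adj_bounded.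

End Adjoint.

Fixpoint ndual (X : normedModType K) (k : nat) : normedModType K :=
  if k is k'.+1 then dual (ndual X k') else X.

Fixpoint arens_ext (X Y Z : normedModType K) (m : bounded_bilinear X Y Z)
    (j : nat) : bounded_bilinear (ndual X j.*2) (ndual Y j.*2) (ndual Z j.*2) :=
  if j is j'.+1 then adj (adj (adj (arens_ext m j'))) else m.

(* Algebras are not assumed to be unital. *)
Record banach_algebra (A : completeNormedModType K) := BanachAlgebra {
  alg_mul :> bounded_bilinear A A A;
  alg_mulA : forall a b c, alg_mul a (alg_mul b c) = alg_mul (alg_mul a b) c;
  alg_norm_mul : forall a b, `|alg_mul a b| <= `|a| * `|b|
}.

Record banach_bimodule (A : completeNormedModType K) (mA : banach_algebra A)
    (B : completeNormedModType K) := BanachBimodule {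
  lact : bounded_bilinear A B B;
  ract : bounded_bilinear B A B;
  lactA : forall a1 a2 b, lact (mA a1 a2) b = lact a1 (lact a2 b);
  ractA : forall b a1 a2, ract b (mA a1 a2) = ract (ract b a1) a2;
  lractA : forall a1 b a2, ract (lact a1 b) a2 = lact a1 (ract b a2)
}.

Section EvenDuals.
Variables (A : completeNormedModType K) (mA : banach_algebra A).
Variables (B : completeNormedModType K) (mB : banach_bimodule mA B).

(* The index j stands for the even level k = 2j of the tower of duals, except
   in the two left centers below, where k = 2j + 2 so that the preduals of
   A^(k) and B^(k) exist. *)

Definition mul_ext j : bounded_bilinear (ndual A j.*2) (ndual A j.*2)
  (ndual A j.*2) := arens_ext mA j.

Definition lact_ext j : bounded_bilinear (ndual A j.*2) (ndual B j.*2)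
  (ndual B j.*2) := arens_ext (lact mB) j.

Definition ract_ext j : bounded_bilinear (ndual B j.*2) (ndual A j.*2)
  (ndual B j.*2) := arens_ext (ract mB) j.

(* b^(k+1) b^(k) : a |-> <b^(k+1), b^(k) a> *)
Definition dual_mod_mul j (b' : ndual B j.*2.+1) (b : ndual B j.*2) :
  ndual A j.*2.+1 := adj (ract_ext j) b' b.

(* b^(k+1) a^(k) : b |-> <b^(k+1), a^(k) b> *)
Definition dual_mod_ract j (b' : ndual B j.*2.+1) (a : ndual A j.*2) :
  ndual B j.*2.+1 := adj (lact_ext j) b' a.

Definition left_center j : set (ndual B j.+1.*2) :=
  [set b | continuous (ract_ext j.+1 b :
     weak_star (ndual A j.*2.+1) -> weak_star (ndual B j.*2.+1))].

Definition left_center_weak j : set (ndual B j.+1.*2) :=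
  [set b | continuous (ract_ext j.+1 b :
     weak_star (ndual A j.*2.+1) -> weak (ndual B j.+1.*2))].

Definition has_left_unit_module j :=
  exists e : ndual A j.*2,
    (forall a, mul_ext j e a = a) /\ (forall b, lact_ext j e b = b).

End EvenDuals.

End Bilinear.

Arguments bidual_emb {R s} X x.
Arguments weak_star {R s} X.
Arguments weak {R s} X.
Arguments mul_ext {R s A} mA j.
Arguments lact_ext {R s A mA B} mB j.
Arguments ract_ext {R s A mA B} mB j.
Arguments dual_mod_mul {R s A mA B} mB j b' b.
Arguments dual_mod_ract {R s A mA B} mB j b' a.
Arguments left_center {R s A mA B} mB j.
Arguments left_center_weak {R s A mA B} mB j.
Arguments has_left_unit_module {R s A mA B} mB j.

(* Main.v *)
From HB Require Import structures.
Require Import Defs.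
From mathcomp Require Import all_boot all_order all_algebra.
From mathcomp Require Import complex.
From mathcomp Require Import all_classical all_reals.
From mathcomp Require Import topology normedtype.
From mathcomp Require Import ring lra.

(** Part 1. Suppose every functional a |-> <b', b a> on A^(n-1) has the form
    a |-> <a, x> with x in A^(n-2). Such a functional is weak*-continuous by
    the very definition of the weak* topology, so a |-> b a is
    weak*-to-weak continuous for every b. Both centers are then all of
    B^(n-1): the evaluations defining weak* are among those defining weak.

    Part 2. If e is a left unit acting as the identity on B^(n-1), then
    <b' e, b> = <b', e b> = <b', b>, that is b' e = b'. The inclusion then says
    that B^(n) is contained in B^(n-2): the odd dual B^(n-2) is reflexive.
    Reflexivity descends the tower of duals to B one step at a time
    ([reflexive_of_dual], [reflexive_of_ndual]). Indeed let X' be reflexive, and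
    let u in X'' be at positive distance from X. The Hahn-Banach theorem gives
    a functional f on X'' that vanishes on X but not at u; by reflexivity f is
    the evaluation at some g in X', and f = 0 on X means g = 0, so f = 0, a
    contradiction. This shows that X = X'' once X is norm-closed in X''. It is
    closed when X is complete, which settles the last step of the descent
    ([bidual_emb_closed]), and it is closed whenever X is itself a dual, because
    X''' retracts onto X' by the adjoint of X -> X''
    ([bidual_emb_dual_closed]).

    Hahn-Banach is proved for a seminorm q and a point x0: there is a linear f
    with |f| <= q and |f x0| = q x0 ([hahn_banach]). Applied to the distance to
    a subspace it separates a point from that subspace, and applied to the norm
    it shows that X -> X'' is isometric. Over the reals, f is a minimal
    sublinear functional, supplied by Zorn's lemma; over the complex numbers it
    is u x - i u (i x) for a real solution u. *)

Import Order.TTheory GRing.Theory Num.Theory.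
Import numFieldNormedType.Exports.

Local Open Scope classical_set_scope.
Local Open Scope ring_scope.

(** * The real Hahn-Banach theorem *)

Section RealHahnBanach.
Context {R : realType} {V : lmodType R}.
Implicit Types (p q : V -> R) (x y : V).

(** Homogeneity is required as an inequality for t >= 0; the equality follows
    ([sublinearZ]). *)
Definition sublinear q :=
  (forall x y, q (x + y) <= q x + q y) /\
  (forall (t : R) x, 0 <= t -> q (t *: x) <= t * q x).

Lemma sublinear0 q : sublinear q -> q 0 = 0.
Proof.
move=> [qD qZ]; have := qD 0 0; have := qZ 0 0 (lexx 0).
rewrite scale0r addr0 mul0r => h1 h2; lra.
Qed.

Lemma sublinearZ q (t : R) x : sublinear q -> 0 <= t -> q (t *: x) = t * q x.
Proof.
move=> q_sub; have [qD qZ] := q_sub.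
rewrite le0r => /orP[/eqP ->|t0].
  by rewrite scale0r mul0r sublinear0.
apply/eqP; rewrite eq_le qZ ?(ltW t0)//=.
have ti0 : 0 <= t^-1 by rewrite invr_ge0 ltW.
have := qZ t^-1 (t *: x) ti0.
by rewrite scalerA mulVf ?gt_eqF// scale1r ler_pdivlMl.
Qed.

Lemma sublinear_ge q x : sublinear q -> - q (- x) <= q x.
Proof.
move=> q_sub; have [qD _] := q_sub.
have := qD x (- x); rewrite subrr sublinear0// => h; lra.
Qed.

(** The largest sublinear functional r below q with r (- y) <= - q y; a linear
    functional below it is therefore at least q y at y. *)
Definition tilt q y x :=
  inf [set q (x + t *: y) - t * q y | t in [set t | 0 <= t]].

Lemma tilt_le q y (t : R) x : sublinear q -> 0 <= t ->
  tilt q y x <= q (x + t *: y) - t * q y.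
Proof.
move=> q_sub t0; apply: ge_inf; last by exists t.
exists (- q (- x)) => _ [r /= r0 <-].
have [qD _] := q_sub; have := qD (x + r *: y) (- x).
rewrite addrAC subrr add0r sublinearZ// => h; lra.
Qed.

Lemma le_tilt q y x z :
  (forall t : R, 0 <= t -> z <= q (x + t *: y) - t * q y) -> z <= tilt q y x.
Proof.
move=> h; apply: lb_le_inf.
  by exists (q (x + 0 *: y) - 0 * q y), 0 => /=.
by move=> _ [t /= t0 <-]; exact: h.
Qed.

Lemma tilt_sublinear q y : sublinear q -> sublinear (tilt q y).
Proof.
move=> q_sub; have [qD _] := q_sub; split=> [x x'|r x].
  rewrite -lerBlDl; apply: le_tilt => t t0.
  rewrite lerBlDl -lerBlDr; apply: le_tilt => t' t'0.
  have := tilt_le q y (t + t') (x + x') q_sub (addr_ge0 t0 t'0).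
  have := qD (x + t' *: y) (x' + t *: y).
  have -> : x + t' *: y + (x' + t *: y) = x + x' + (t + t') *: y.
    by rewrite addrACA (addrC t) scalerDl.
  by move=> h1 h2; lra.
rewrite le0r => /orP[/eqP ->|r0].
  have := tilt_le q y 0 0 q_sub (lexx 0).
  by rewrite !scale0r addr0 !mul0r (sublinear0 q q_sub) subr0.
rewrite mulrC -ler_pdivrMr//; apply: le_tilt => t t0.
rewrite ler_pdivrMr//.
apply: le_trans (tilt_le q y (r * t) _ q_sub _) _.
  by rewrite mulr_ge0// ltW.
rewrite -scalerA -scalerDr (sublinearZ q r) ?(ltW r0)//; lra.
Qed.

(** Zorn's lemma applies because the pointwise infimum m of a nonempty chain F
    is again sublinear: of two members of F, the smaller one serves to bound
    m (x + y). It is finite, as q x >= - q (- x) >= - p (- x) for q <= p. *)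
Lemma minimal_sublinear p : sublinear p ->
  exists2 q, sublinear q /\ (forall x, q x <= p x) &
    forall r, sublinear r -> (forall x, r x <= q x) -> r = q.
Proof.
move=> p_sub.
pose P q := sublinear q /\ (forall x, q x <= p x).
pose ge (q r : {q | P q}) : bool := `[< forall x, sval r x <= sval q x >].
have [|q q' r /asboolP qq' /asboolP q'r|q r /asboolP qr /asboolP rq|
  F Fchain|] := @Zorn {q | P q} ge.
- by move=> q; apply/asboolP => x.
- by apply/asboolP => x; exact: le_trans (q'r x) (qq' x).
- case: q r qr rq => [q Pq] [r Pr] /= qr rq; apply: eq_exist.
  by apply/funext => x; apply/eqP; rewrite eq_le qr rq.
- have [[q0 Fq0]|F0] := pselect (F !=set0); last first.
    exists (exist P p (conj p_sub (fun x => lexx _))) => s Fs.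
    by case: F0; exists s.
  pose m x := inf [set sval q x | q in F].
  have m_le (g : {q | P q}) x : F g -> m x <= sval g x.
    move=> Fg; apply: ge_inf; last by exists g.
    exists (- p (- x)) => _ [[r [r_sub rp]] Fr <-] /=.
    by apply: le_trans (sublinear_ge _ x r_sub); rewrite lerN2.
  have le_m x z : (forall g, F g -> z <= sval g x) -> z <= m x.
    move=> h; apply: lb_le_inf; first by exists (sval q0 x), q0.
    by move=> _ [q Fq <-]; exact: h.
  have Pm : P m.
    split; last first.
      by move=> x; apply: le_trans (m_le q0 x Fq0) _; exact: (svalP q0).2.
    split=> [x y|t x t0].
      rewrite -lerBlDl; apply: (le_m) => q Fq.
      rewrite lerBlDl -lerBlDr; apply: (le_m) => r Fr; rewrite lerBlDr.
      have [/asboolP le|/asboolP le] := Fchain q r Fq Fr.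
        apply: le_trans (m_le r _ Fr) _.
        apply: le_trans ((svalP r).1.1 x y) _.
        by rewrite lerD2l; exact: le.
      apply: le_trans (m_le q _ Fq) _.
      apply: le_trans ((svalP q).1.1 x y) _.
      by rewrite lerD2r; exact: le.
    move: t0; rewrite le0r => /orP[/eqP ->|t0].
      rewrite scale0r mul0r; apply: le_trans (m_le q0 _ Fq0) _.
      by rewrite (sublinear0 _ (svalP q0).1).
    rewrite mulrC -ler_pdivrMr//; apply: le_m => q Fq.
    rewrite ler_pdivrMr// mulrC; apply: le_trans (m_le q _ Fq) _.
    by apply: (svalP q).1.2; exact: ltW.
  by exists (exist P m Pm) => q Fq; apply/asboolP => x; exact: m_le.
move=> [q [q_sub qp]] qmin; exists q => // r r_sub rq.
have Pr : P r by split=> // x; exact: le_trans (rq x) (qp x).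
have := qmin (exist P r Pr); rewrite /ge /= => /(_ _)/(congr1 sval) /= -> //.
by apply/asboolP.
Qed.

(** A minimal sublinear f equals tilt f y for every y, and the bound at t = 1
    reads f x <= f (x + y) - f y: f is additive. Starting below tilt p x0
    instead of p forces the value p x0 at x0. *)
Theorem real_hahn_banach p x0 : sublinear p ->
  exists f : V -> R, [/\ forall x y, f (x + y) = f x + f y,
    forall (t : R) x, f (t *: x) = t * f x,
    forall x, f x <= p x & f x0 = p x0].
Proof.
move=> p_sub.
have [f [f_sub fp] fmin] := minimal_sublinear _ (tilt_sublinear _ x0 p_sub).
have fD x y : f (x + y) = f x + f y.
  have fy : tilt f y = f.
    apply: fmin; first exact: tilt_sublinear.
    move=> z; have := tilt_le f y 0 z f_sub (lexx 0).
    by rewrite scale0r addr0 mul0r subr0.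
  have := tilt_le f y 1 x f_sub ler01; rewrite scale1r mul1r fy.
  by have := f_sub.1 x y => h1 h2; lra.
have fN x : f (- x) = - f x.
  by have := fD x (- x); rewrite subrr (sublinear0 _ f_sub) => h; lra.
have fle x : f x <= p x.
  apply: le_trans (fp x) _; have := tilt_le p x0 0 x p_sub (lexx 0).
  by rewrite scale0r addr0 mul0r subr0.
exists f; split=> // [t x|].
  have [t0|t0] := leP 0 t; first exact: sublinearZ.
  rewrite -[t]opprK scaleNr fN sublinearZ ?mulNr// oppr_ge0; exact: ltW.
apply/eqP; rewrite eq_le fle/= -lerN2 -fN.
apply: le_trans (fp _) _.
have := tilt_le p x0 1 (- x0) p_sub ler01.
by rewrite scale1r addNr sublinear0// mul1r add0r.
Qed.

End RealHahnBanach.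

(** * Hahn-Banach over both kinds of scalars *)

Definition of_real {R : realType} {s : scalar_kind} : R -> scalars R s :=
  match s return R -> scalars R s with
  | RealScalars => id
  | ComplexScalars => real_complex R
  end.

(** The absolute value as a real number, so that infima of distances can be
    taken in R. *)
Definition modulus {R : realType} {s : scalar_kind} : scalars R s -> R :=
  match s return scalars R s -> R with
  | RealScalars => fun z => `|z|
  | ComplexScalars => fun z => complex.Re `|z|
  end.

Section Modulus.
Context {R : realType} {s : scalar_kind}.
Local Notation K := (scalars R s).

Lemma of_real_modulus (z : K) : of_real (modulus z) = `|z|.
Proof. by case: s z. Qed.

Lemma ler_of_real (x y : R) : (of_real x <= of_real y :> K) = (x <= y).
Proof. by case: s => //=; rewrite lecR. Qed.

Lemma of_real0 : of_real 0 = 0 :> K.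
Proof. by case: s. Qed.

Lemma of_realD (x y : R) : of_real (x + y) = of_real x + of_real y :> K.
Proof. by case: s => //=; rewrite rmorphD. Qed.

Lemma of_realM (x y : R) : of_real (x * y) = of_real x * of_real y :> K.
Proof. by case: s => //=; rewrite rmorphM. Qed.

Lemma modulus_ge0 (z : K) : 0 <= modulus z.
Proof. by rewrite -ler_of_real of_real_modulus of_real0. Qed.

Lemma of_real_modulus_norm (X : normedModType K) (x : X) :
  of_real (modulus `|x|) = `|x| :> K.
Proof. by rewrite of_real_modulus normr_id. Qed.

End Modulus.

(** Restriction of scalars along R -> R[i]. *)
Definition realification {R : realType} (V : lmodType R[i]) : Type := V.

Section Realification.
Context {R : realType} (V : lmodType R[i]).
Local Notation RV := (realification V).

HB.instance Definition _ := GRing.Zmodule.on RV.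

Let rscale (t : R) (x : RV) : RV := (t%:C%C : R[i]) *: (x : V).

Fact rscaleA a b x : rscale a (rscale b x) = rscale (a * b) x.
Proof. by rewrite /rscale scalerA rmorphM. Qed.

Fact rscale1 : left_id 1 rscale.
Proof. by move=> x; rewrite /rscale rmorph1 scale1r. Qed.

Fact rscaleDr : right_distributive rscale +%R.
Proof. by move=> a x y; rewrite /rscale scalerDr. Qed.

Fact rscaleDl x : {morph rscale^~ x : a b / a + b}.
Proof. by move=> a b; rewrite /rscale rmorphD scalerDl. Qed.

HB.instance Definition _ := GRing.Zmodule_isLmodule.Build R RV
  rscaleA rscale1 rscaleDr rscaleDl.

Lemma realificationZ (t : R) (x : RV) : t *: x = (t%:C%C : R[i]) *: (x : V).
Proof. by []. Qed.

End Realification.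

(** From a real solution u, f x = u x - i u (i x) is complex-linear with real
    part u. The bound on f follows by rotating x: for |c| = 1 with
    f (c x) = |f x|, one has |f x| = u (c x) <= q (c x) = q x. *)
Lemma complex_hahn_banach {R : realType} (V : lmodType R[i]) (q : V -> R)
    (x0 : V) :
  (forall x y, q (x + y) <= q x + q y) ->
  (forall a x, (q (a *: x))%:C%C = `|a| * (q x)%:C%C) ->
  exists f : V -> R[i]^o, [/\ linear f,
    forall x, `|f x| <= (q x)%:C%C & `|f x0| = (q x0)%:C%C].
Proof.
move=> qD qZ.
have q_sub : @sublinear R (realification V) q.
  split=> // t x t0; rewrite -lecR realificationZ qZ rmorphM.
  by rewrite normc_def /= expr0n addr0 sqrtr_sqr ger0_norm.
have [u [uD uZ uq ux0]] := @real_hahn_banach R (realification V) q x0 q_sub.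
have {}uD (x y : V) : u (x + y) = u x + u y by exact: uD.
have {}uZ t (x : V) : u (t%:C%C *: x) = t * u x by exact: uZ.
pose f (x : V) : R[i]^o := (u x -i* u ('i%C *: x))%C.
have fD x y : f (x + y) = f x + f y.
  by rewrite /f scalerDr !uD; apply/eqP; rewrite eq_complex /= opprD !eqxx.
have fZ a x : f (a *: x) = a * f x.
  have expand y :
      u (a *: y) = complex.Re a * u y + complex.Im a * u ('i%C *: y).
    rewrite {1}[a]complexE scalerDl uD uZ.
    by rewrite [_ * (complex.Im a)%:C%C]mulrC -scalerA uZ.
  have ii : u ('i%C *: ('i%C *: x)) = - u x.
    rewrite scalerA -expr2 sqr_i.
    have -> : (-1 : R[i]) = (-1)%:C%C by rewrite rmorphN rmorph1.
    by rewrite uZ mulN1r.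
  apply/eqP; rewrite /f scalerA mulrC -scalerA !expand ii.
  case: a {expand} => a b; rewrite eq_complex /=.
  by apply/andP; split; apply/eqP; ring.
have q0 x : 0 <= q x.
  have := qD x (-1 *: x); have := qZ (-1) x.
  rewrite normrN1 mul1r => /complexI ->.
  have : q 0 = 0 by apply: complexI; rewrite -(scale0r x) qZ normr0 mul0r.
  by rewrite scaleN1r subrr => -> h; lra.
have fq x : `|f x| <= (q x)%:C%C.
  have [->|fx0] := eqVneq (f x) 0; first by rewrite normr0 ler0c.
  set c : R[i] := `|f x| / f x.
  have c1 : `|c| = 1 by rewrite normrM normr_id normfV divff// normr_eq0.
  have fcx : f (c *: x) = `|f x| by rewrite fZ mulfVK.
  have -> : `|f x| = (u (c *: x))%:C%C.
    have := normr_ge0 (f x); rewrite -fcx /f lecE /= => /andP[/eqP ->] _.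
    by [].
  rewrite lecR; apply: le_trans (uq _) _.
  by rewrite -lecR qZ c1 mul1r.
exists f; split=> // [a x y|]; first by rewrite fD fZ.
apply/eqP; rewrite eq_le fq/= -ux0.
apply: le_trans (normc_ge_Re _).
by rewrite lecR /= ler_norm.
Qed.

Theorem hahn_banach {R : realType} {s : scalar_kind}
    (V : lmodType (scalars R s)) (q : V -> R) (x0 : V) :
  (forall x y, q (x + y) <= q x + q y) ->
  (forall a x, of_real (q (a *: x)) = `|a| * of_real (q x)) ->
  exists f : V -> (scalars R s)^o, [/\ linear f,
    forall x, `|f x| <= of_real (q x) & `|f x0| = of_real (q x0)].
Proof.
case: s V q x0 => /= V q x0 qD qZ; last exact: complex_hahn_banach.
have qN x : q (- x) = q x by rewrite -scaleN1r qZ normrN1 mul1r.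
have q_sub : sublinear q by split=> // t x t0; rewrite qZ ger0_norm.
have [f [fD fZ fq fx0]] := real_hahn_banach q x0 q_sub.
have fN x : f (- x) = - f x by rewrite -scaleN1r fZ mulN1r.
have fabs x : `|f x| <= q x by rewrite ler_norml fq lerNl -fN -qN fq.
exists f; split=> // [a x y|]; first by rewrite fD fZ.
by apply/eqP; rewrite eq_le fabs/= -fx0 ler_norm.
Qed.

(** * Separation and the embedding into the bidual *)

Section Reflexivity.
Context {R : realType} {s : scalar_kind}.
Local Notation K := (scalars R s).
Implicit Types X : normedModType K.

(** Hahn-Banach for the seminorm q x = distance of x to M, at u: f vanishes
    where q does, q is bounded by the norm, and q u >= d > 0. *)
Lemma dual_separation X (M : set X) (u : X) (d : K) :
  M 0 -> (forall x y, M x -> M y -> M (x + y)) ->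
  (forall (a : K) x, M x -> M (a *: x)) ->
  0 < d -> (forall x, M x -> d <= `|u - x|) ->
  exists f : dual X, (forall x, M x -> f x = 0) /\ f u != 0.
Proof.
move=> M0 MD MZ d0 Md.
pose S x := [set modulus `|x - y| | y in M].
pose q x := inf (S x).
have normE := @of_real_modulus_norm R s X.
have lbS x : has_lbound (S x).
  by exists 0 => _ [y _ <-]; exact: modulus_ge0.
have q_le x y : M y -> q x <= modulus `|x - y|.
  by move=> My; apply: ge_inf => //; exists y.
have le_q x z : (forall y, M y -> z <= modulus `|x - y|) -> z <= q x.
  move=> h; apply: lb_le_inf; first by exists (modulus `|x - 0|), 0.
  by move=> _ [y My <-]; exact: h.
have q_ge0 x : 0 <= q x by apply: (le_q) => y _; exact: modulus_ge0.
have q_norm x : of_real (q x) <= `|x|.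
  by rewrite -normE ler_of_real -[in leRHS](subr0 x); exact: q_le.
have qD x y : q (x + y) <= q x + q y.
  rewrite -lerBlDl; apply: (le_q) => v Mv.
  rewrite lerBlDl -lerBlDr; apply: (le_q) => w Mw; rewrite lerBlDr.
  apply: le_trans (q_le _ (w + v) (MD _ _ Mw Mv)) _.
  by rewrite -(ler_of_real (s := s)) of_realD !normE opprD addrACA ler_normD.
have qZle (a : K) x : q (a *: x) <= modulus a * q x.
  have [->|a0] := eqVneq a 0.
    rewrite scale0r; apply: le_trans (q_le _ 0 M0) _.
    rewrite -(ler_of_real (s := s)) normE subr0 normr0 of_realM of_real_modulus.
    by rewrite normr0 mul0r.
  have ma0 : 0 < modulus a.
    rewrite lt_neqAle modulus_ge0 andbT; apply: contra_neq a0 => /esym m0.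
    by apply/eqP; rewrite -normr_eq0 -of_real_modulus m0 of_real0.
  rewrite mulrC -ler_pdivrMr//; apply: (le_q) => y My.
  rewrite ler_pdivrMr//; apply: le_trans (q_le _ (a *: y) (MZ a y My)) _.
  rewrite -(ler_of_real (s := s)) of_realM !normE of_real_modulus.
  by rewrite -scalerBr normrZ mulrC.
have qZ (a : K) x : of_real (q (a *: x)) = `|a| * of_real (q x).
  rewrite -of_real_modulus -of_realM; congr of_real.
  apply/eqP; rewrite eq_le qZle/=.
  have [->|a0] := eqVneq a 0.
    apply: le_trans (q_ge0 _).
    rewrite -(ler_of_real (s := s)) of_realM of_real_modulus normr0 mul0r.
    by rewrite of_real0.
  have := qZle a^-1 (a *: x); rewrite scalerA mulVf// scale1r => h.
  apply: le_trans (ler_wpM2l (modulus_ge0 a) h) _.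
  rewrite -(ler_of_real (s := s)) !of_realM !of_real_modulus mulrA -normrM.
  by rewrite divff// normr1 mul1r.
have [f [f_lin fq fu]] := hahn_banach X q u qD qZ.
have f_bnd x : `|f x| <= 1 * `|x|.
  by rewrite mul1r; exact: le_trans (fq x) (q_norm x).
exists (Dual (@mk_dual_subproof _ _ _ f f_lin 1 ler01 f_bnd)).
split=> [x Mx|] /=.
  apply/eqP; rewrite -normr_le0; apply: le_trans (fq x) _.
  rewrite -of_real0 ler_of_real; apply: le_trans (q_le _ x Mx) _.
  by rewrite -(ler_of_real (s := s)) normE subrr normr0 of_real0.
rewrite -normr_eq0 fu gt_eqF//; apply: lt_le_trans (d0) _.
have -> : d = of_real (modulus d) by rewrite of_real_modulus gtr0_norm.
rewrite ler_of_real; apply: (le_q) => y My.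
by rewrite -(ler_of_real (s := s)) normE of_real_modulus gtr0_norm//; exact: Md.
Qed.

Lemma ler_dual_norm X (f : dual X) (x : X) : `|f x| <= `|f| * `|x|.
Proof. exact: le_op_norm. Qed.

Lemma bidual_emb_is_linear X : linear (bidual_emb X).
Proof. by move=> a x y; apply/val_inj/funext => f /=; rewrite linearP. Qed.

HB.instance Definition _ X :=
  GRing.isLinear.Build K X (dual (dual X)) _ (bidual_emb X)
    (bidual_emb_is_linear X).

Lemma bidual_emb_norm_le X (x : X) : `|bidual_emb X x| <= `|x|.
Proof.
by apply: op_norm_le => // f; rewrite mulrC; exact: (ler_dual_norm _ f x).
Qed.

(** The lower bound is witnessed by a functional of norm at most 1 whose value
    at x has modulus |x|: Hahn-Banach for the norm. *)
Lemma bidual_emb_norm X (x : X) : `|bidual_emb X x| = `|x|.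
Proof.
apply/eqP; rewrite eq_le bidual_emb_norm_le/=.
have normE := @of_real_modulus_norm R s X.
have [||f [f_lin f_le fx]] := hahn_banach X (fun y => modulus `|y|) x.
- move=> y z; rewrite -(ler_of_real (s := s)) of_realD !normE.
  exact: ler_normD.
- by move=> a y; rewrite !normE normrZ.
have f_bnd y : `|f y| <= 1 * `|y| by rewrite mul1r -normE.
pose g : dual X := Dual (@mk_dual_subproof _ _ _ f f_lin 1 ler01 f_bnd).
have g1 : `|g| <= 1 by exact: op_norm_le.
rewrite -normE -fx; apply: le_trans (ler_dual_norm _ (bidual_emb X x) g) _.
by rewrite ler_piMr.
Qed.

(** * Descent of reflexivity *)

Definition norm_closed X (M : set X) :=
  forall u, (forall d : K, 0 < d -> exists2 x, M x & `|u - x| < d) -> M u.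

(** A functional on X'' that vanishes on X is, by reflexivity of X', the
    evaluation at some g in X', and then g = 0; so nothing separates a point of
    X'' from X. *)
Lemma reflexive_of_dual X : norm_closed _ (range (bidual_emb X)) ->
  reflexive_space (dual X) -> reflexive_space X.
Proof.
move=> clX rX; apply/seteqP; split=> // u _; apply: contrapT => nu.
have [d d0 du] : exists2 d : K, 0 < d & forall x, d <= `|u - bidual_emb X x|.
  apply: contrapT => nd; apply: nu; apply: clX => d d0.
  apply: contrapT => nx; apply: nd; exists d => // x.
  rewrite real_leNgt ?ger0_real ?(ltW d0)//.
  by apply/negP => lt; apply: nx; exists (bidual_emb X x) => //; exists x.
have [||| | |f [f0 fu]] := dual_separation _ (range (bidual_emb X)) u d.
- by exists 0; rewrite // linear0.
- by move=> _ _ [x _ <-] [y _ <-]; exists (x + y); rewrite // linearD.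
- by move=> a _ [x _ <-]; exists (a *: x); rewrite // linearZ.
- exact: d0.
- by move=> _ [x _ <-]; exact: du.
have [g _ fE] : range (bidual_emb (dual X)) f by rewrite rX.
move/eqP: fu; apply; rewrite -fE /=.
have -> : g = 0.
  apply/val_inj/funext => x; rewrite /= -[RHS](f0 (bidual_emb X x)).
    by rewrite -fE.
  by exists x.
by rewrite linear0.
Qed.

(** The sets N d of the points of X at distance less than d from u generate a
    Cauchy filter, since the embedding is isometric, and the embedding maps its
    limit to u. *)
Lemma bidual_emb_closed (X : completeNormedModType K) :
  norm_closed _ (range (bidual_emb X)).
Proof.
move=> u near_u.
pose N (d : K) := [set x | `|u - bidual_emb X x| < d].
pose F := filter_from [set d : K | 0 < d] N.
have N_pos d : 0 < d -> N d !=set0.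
  by move=> /near_u[_ [x _ <-] xd]; exists x.
have FF : ProperFilter F.
  apply: filter_from_proper => //; apply: filter_from_filter.
    by exists 1 => /=.
  move=> d d' /= d0 d'0; exists (Num.min d d').
    by rewrite /= /Num.min; case: ifP.
  move=> x; rewrite /N/= => h.
  have dd : d >=< d' by apply: real_comparable; exact: ger0_real (ltW _).
  by split; apply: lt_le_trans h _; rewrite comparable_ge_min ?lexx ?orbT.
have cauchyF : cauchy F.
  apply/cauchy_exP => e e0 /=.
  have e20 : 0 < e / 2 by rewrite divr_gt0.
  have [x Nx] := N_pos _ e20; exists x, (e / 2) => // y Ny.
  rewrite -ball_normE /= -bidual_emb_norm linearB/= [e]splitr.
  rewrite -(subrK u (bidual_emb X x)) -addrA.
  by apply: le_lt_trans (ler_normD _ _) _; rewrite ltrD// distrC.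
have /cvg_ex[l Fl] : cvg F by exact: cauchy_cvg.
exists l => //; apply/esym/eqP; rewrite -subr_eq0 -normr_eq0.
apply/eqP/le_anti; rewrite normr_ge0 andbT.
apply/ler_addgt0Pr => e e0; rewrite add0r.
have e20 : 0 < e / 2 by rewrite divr_gt0.
have [|x [lx Nx]] := @filter_ex _ F _ (ball l (e / 2) `&` N (e / 2)).
  by apply: filterI; [exact: Fl (nbhsx_ballx _ _ e20)|exists (e / 2)].
rewrite [e]splitr -(subrK (bidual_emb X x) u) -addrA.
apply: le_trans (ler_normD _ _) _; apply: lerD; first exact: ltW.
rewrite -linearB bidual_emb_norm distrC.
by move: lx; rewrite -ball_normE => /ltW.
Qed.

Lemma bidual_adjoint_subproof X (u : dual (dual (dual X))) :
  (fun x => u (bidual_emb X x)) \in @bounded_functional R s X.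
Proof.
apply: (@mk_dual_subproof _ _ _ _ _ `|u|) => // [a x y|x].
  by rewrite !linearP.
by rewrite -(bidual_emb_norm _ x); exact: ler_dual_norm.
Qed.

(** The adjoint X''' -> X' of the embedding of X into X''. *)
Definition bidual_adjoint X (u : dual (dual (dual X))) : dual X :=
  Dual (bidual_adjoint_subproof X u).

(** The adjoint P of X -> X'' is a contraction with P (emb f) = f. If u is
    within d of emb f, then P u is within d of f, so u is within 2 d of
    emb (P u); letting d tend to 0 gives u = emb (P u). *)
Lemma bidual_emb_dual_closed X : norm_closed _ (range (bidual_emb (dual X))).
Proof.
pose P := bidual_adjoint X.
have P_linear u v : P (u - v) = P u - P v by apply/val_inj/funext.
have PK f : P (bidual_emb (dual X) f) = f by apply/val_inj/funext.
have P_le u : `|P u| <= `|u|.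
  apply: op_norm_le => // x; rewrite -(bidual_emb_norm _ x).
  exact: (ler_dual_norm _ u (bidual_emb X x)).
move=> u near_u; exists (P u) => //; apply/esym/eqP.
rewrite -subr_eq0 -normr_eq0; apply/eqP/le_anti; rewrite normr_ge0 andbT.
apply/ler_addgt0Pr => e e0; rewrite add0r.
have e20 : 0 < e / 2 by rewrite divr_gt0.
have [_ [f _ <-] ltf] := near_u _ e20.
rewrite [e]splitr -(subrK (bidual_emb _ f) u) -addrA.
apply: le_trans (ler_normD _ _) _; apply: lerD; first exact: ltW.
rewrite subrK -linearB bidual_emb_norm -[in X in X - _](PK f) -P_linear.
by apply: le_trans (P_le _) _; rewrite distrC ltW.
Qed.

Lemma reflexive_of_ndual (X : completeNormedModType K) k :
  reflexive_space (ndual X k) -> reflexive_space X.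
Proof.
elim: k => // k IHk rX; apply/IHk/reflexive_of_dual => //.
case: k {IHk rX} => [|k]; first exact: bidual_emb_closed.
exact: bidual_emb_dual_closed.
Qed.

(** * Weak and weak* continuity *)

Lemma continuous_ptws {T V : topologicalType} {I : eqType}
    (h : T -> {ptws I -> V}) :
  (forall i, continuous (fun t => h t i)) -> continuous h.
Proof.
move=> ch t; apply/cvg_sup => i U [_ [[W oW <-]] Wht WU].
apply: filterS WU _; apply: ch.
exact: open_nbhs_nbhs.
Qed.

Lemma continuous_weak_star X (T : topologicalType) (g : T -> weak_star X) :
  (forall x : X, continuous (fun t => (g t : dual X) x)) -> continuous g.
Proof.
by move=> cg; apply: continuous_comp_initial; exact: continuous_ptws.
Qed.

Lemma weak_star_eval X (x : X) :
  continuous (fun f : weak_star X => (f : dual X) x).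
Proof.
pose h : weak_star X -> {ptws X -> K^o} := fun f => (f : dual X) : X -> K^o.
have h_cont : continuous h by exact: initial_continuous.
have px := @proj_continuous X (fun _ => K^o) x.
by move=> f; exact: (continuous_comp (h_cont f) (px (h f))).
Qed.

Lemma continuous_weak X (T : topologicalType) (g : T -> weak X) :
  (forall f : dual X, continuous (fun t => f (g t : X))) -> continuous g.
Proof.
by move=> cg; apply: continuous_comp_initial; exact: continuous_ptws.
Qed.

Lemma weak_eval X (f : dual X) : continuous (fun x : weak X => f (x : X)).
Proof.
pose h : weak X -> {ptws dual X -> K^o} :=
  fun x => bidual_emb X x : dual X -> K^o.
have h_cont : continuous h by exact: initial_continuous.
have pf := @proj_continuous (dual X) (fun _ => K^o) f.
by move=> x; exact: (continuous_comp (h_cont x) (pf (h x))).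
Qed.

End Reflexivity.

(** * The theorem *)

Theorem mainTheorem3 (R : realType) (s : scalar_kind)
  (A : completeNormedModType (scalars R s)) (mA : banach_algebra A)
  (B : completeNormedModType (scalars R s)) (mB : banach_bimodule mA B)
  (n j : nat) (n_ge2 : (2 <= n)%N) (n_odd : odd n) (nE : n = j.*2.+3) :
  ([set dual_mod_mul mB j.+1 b' b | b' in [set: ndual B j.*2.+3]
                                  & b in [set: ndual B j.*2.+2]]
     `<=` range (bidual_emb (ndual A j.*2.+1)) ->
   left_center mB j = left_center_weak mB j)
  /\
  ([set dual_mod_ract mB j.+1 b' a | b' in [set: ndual B j.*2.+3]
                                   & a in [set: ndual A j.*2.+2]]
     `<=` range (bidual_emb (ndual B j.*2.+1)) ->
   has_left_unit_module mB j.+1 ->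
   reflexive_space B).
Proof.
split=> [inA|inB [e [_ eb]]].
  apply/seteqP; split=> b bZ.
    apply: continuous_weak => b'.
    have [x _ xE] : range (bidual_emb (ndual A j.*2.+1))
        (dual_mod_mul mB j.+1 b' b).
      by apply: inA; exists b' => //; exists b.
    have -> : (fun a => b' (ract_ext mB j.+1 b a)) =
              (fun a : weak_star (ndual A j.*2.+1) => a x).
      apply/funext => a; symmetry.
      exact: (congr1 (fun f : dual (dual (ndual A j.*2.+1)) => f a) xE).
    exact: weak_star_eval.
  apply: continuous_weak_star => x a.
  have x_cont := weak_eval (ndual B j.*2.+2) (bidual_emb _ x).
  exact: (continuous_comp (bZ a) (x_cont (ract_ext mB j.+1 b a))).
apply: (@reflexive_of_ndual R s B j.*2.+1).
apply/seteqP; split=> // b' _.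
suff <- : dual_mod_ract mB j.+1 b' e = b'.
  by apply: inB; exists b' => //; exists e.
by apply/val_inj/funext => b; rewrite -[in RHS](eb b).
Qed.
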